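(* Let $(n_k)_{k\in\mathbb{N}}$ be an increasing sequence of natural numbers such that for all $\alpha,\beta,\gamma\in\mathcal F$, $$\sum_{j\in\alpha}n_j+\sum_{j\in\beta}n_j=\sum_{j\in\gamma}n_j\quad\text{if and only if}\quad \alpha\cup\beta=\gamma\text{ and }\alpha\cap\beta=\emptyset.$$ Then for every $\ell\ge2$, the set $\mathrm{FS}((n_k)_{k\in\mathbb{N}})$ is not a $\Delta_{\ell,\,14\cdot 2^{\ell-2}}$ set.
   Context: $\mathbb{N}=\{1,2,\dots\}$; $\mathcal F$ is the set of all finite non-empty subsets of $\mathbb{N}$. $\mathrm{FS}((n_k)_{k\in\mathbb{N}})=\{n_{k_1}+\dots+n_{k_m}:k_1<\dots<k_m,\ m\in\mathbb{N}\}$. Define $\partial:\bigcup_{\ell\ge1}\mathbb{Z}^{2^\ell}\to\mathbb{Z}$ recursively by $\partial(m_1,m_2)=m_2-m_1$ and $\partial(m_1,\dots,m_{2^\ell})=\partial(m_{2^{\ell-1}+1},\dots,m_{2^\ell})-\partial(m_1,\dots,m_{2^{\ell-1}})$ for $\ell>1$. For $r\ge2^\ell$, a set $E\subseteq\mathbb{N}$ is a $\Delta_{\ell,r}$ set if there is an $r$-element sequence $(c_k)_{k=1}^r$ in $\mathbb{Z}$ with $\{\partial(c_{j_1},\dots,c_{j_{2^\ell}}):1\le j_1<\dots<j_{2^\ell}\le r\}\subseteq E$. *)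

(* Defs.v *)
From mathcomp Require Import all_boot all_order all_algebra finmap.

Set Implicit Arguments.
Unset Strict Implicit.
Unset Printing Implicit Defensive.

Local Open Scope nat_scope.

(* The natural numbers of the statement start at 1, whereas [nat] contains 0:
   subsets of N are predicates on [nat], and infinite sequences (n_k) are
   functions [nat -> nat] whose value at 0 is irrelevant. *)

Definition in_calF (a : {fset nat}) : Prop := a <> fset0 /\ 0 \notin a.

Definition FS (n : nat -> nat) (x : nat) : Prop :=
  exists s : seq nat,
    [/\ s <> [::], all (fun k => 1 <= k) s, sorted ltn s
      & x = \sum_(k <- s) n k].

(* [partial l m] is meaningful for l >= 1 and [size m = 2 ^ l]; the value at
   l = 0 is junk. *)
Fixpoint partial (l : nat) (m : seq int) : int :=
  match l with
  | 0 => 0%R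
  | l'.+1 =>
      if l' is 0 then (m`_1 - m`_0)%R
      else (partial l' (drop (2 ^ l') m) - partial l' (take (2 ^ l') m))%R
  end.

(* Meaningful for l >= 1 and r >= 2 ^ l. The r-element sequence is indexed by
   'I_r, i.e. by 0, ..., r - 1. *)
Definition is_Delta_set (l r : nat) (E : nat -> Prop) : Prop :=
  exists c : 'I_r -> int,
    forall j : (2 ^ l).-tuple 'I_r,
      sorted ltn [seq nat_of_ord i | i <- j] ->
      exists2 e : nat, E e & partial l [seq c i | i <- j] = Posz e.

(* Main.v *)
Require Import Defs.
From mathcomp Require Import all_boot all_order all_algebra finmap.
From mathcomp Require Import zify ring.

Local Open Scope nat_scope.

(** Replacing [c_1, ..., c_2r] by the differences [c_2k - c_(2k-1)] turns a
    Delta_(l+1,2r) set into a Delta_(l,r) set, so only l = 2 matters.  There, write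
    D(i,j;k,m) = (c_m - c_k) - (c_j - c_i) as the sum of the n_t over a set
    A(i,j;k,m).  The identity D(i,j;k,m) + D(k,m;u,v) = D(i,j;u,v) makes A(i,j;u,v)
    the disjoint union of A(i,j;k,m) and A(k,m;u,v); hence A(4,5;6,7) is contained in
    A(1,2;6,7), so in A(1,2;8,9), and likewise in A(2,3;6,7), so in A(2,3;9,10).  But
    D(1,2;8,9) + D(2,3;9,10) = D(1,3;8,10) shows that A(1,2;8,9) and A(2,3;9,10) are
    disjoint, so A(4,5;6,7) would be empty.  Ten terms thus suffice for l = 2
    (in the code the indices are shifted to 0, ..., 9). *)

Definition sums_only_disjointly (n : nat -> nat) : Prop :=
  forall a b g : {fset nat}, in_calF a -> in_calF b -> in_calF g ->
    \sum_(j <- a) n j + \sum_(j <- b) n j = \sum_(j <- g) n j ->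
    (a `|` b)%fset = g /\ (a `&` b)%fset = fset0.

Definition interleave {T U : Type} (a b : T -> U) (s : seq T) : seq U :=
  flatten [seq [:: a i; b i] | i <- s].

Lemma size_interleave {T U : Type} (a b : T -> U) s :
  size (interleave a b s) = 2 * size s.
Proof. by elim: s => //= x s; rewrite /interleave /= => ->; rewrite mulnS. Qed.

Lemma drop_interleave {T U : Type} (a b : T -> U) k s :
  drop (2 * k) (interleave a b s) = interleave a b (drop k s).
Proof. by elim: k s => [|k IHk] [|x s] //; rewrite mulnS /=; apply: IHk. Qed.

Lemma take_interleave {T U : Type} (a b : T -> U) k s :
  take (2 * k) (interleave a b s) = interleave a b (take k s).
Proof. by elim: k s => [|k IHk] [|x s] //; rewrite mulnS /= IHk. Qed.

Lemma map_interleave {T U V : Type} (f : U -> V) (a b : T -> U) s :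
  [seq f i | i <- interleave a b s] = interleave (f \o a) (f \o b) s.
Proof. by elim: s => //= x s; rewrite /interleave /= => ->. Qed.

Lemma partialSS l m : partial l.+2 m =
  (partial l.+1 (drop (2 ^ l.+1) m) - partial l.+1 (take (2 ^ l.+1) m))%R.
Proof. by []. Qed.

(** Only the innermost level of [partial] subtracts neighbouring entries. The outer levels subtract
    halves, and halving the interleaved list amounts to halving [s]. *)
Lemma partial_interleave {T : Type} (a b : T -> int) l s :
  partial l.+2 (interleave a b s) = partial l.+1 [seq (b i - a i)%R | i <- s].
Proof.
(* For [s] with fewer than two elements, missing entries are read as 0 on both sides. *)
elim: l s => [|l IHl] s; first by case: s => [|x [|y s]] //=; rewrite !subrr.
rewrite partialSS [RHS]partialSS (expnS 2 l.+1).
rewrite drop_interleave take_interleave !IHl.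
by rewrite map_drop map_take.
Qed.

Lemma sorted_interleave_double (s : seq nat) :
  sorted ltn s -> sorted ltn (interleave (fun i => i.*2) (fun i => i.*2.+1) s).
Proof.
elim: s => // x [|y s] IHs /=; first by rewrite ltnS leqnn.
case/andP=> lt_xy /IHs; rewrite /interleave /= => ->.
by rewrite !andbT; lia.
Qed.

Lemma Delta_set_halve l r (E : nat -> Prop) :
  is_Delta_set l.+2 (2 * r) E -> is_Delta_set l.+1 r E.
Proof.
case=> c cE.
have ltl (i : 'I_r) : i.*2 < 2 * r by have := ltn_ord i; lia.
have ltr (i : 'I_r) : i.*2.+1 < 2 * r by have := ltn_ord i; lia.
pose a (i : 'I_r) := Ordinal (ltl i); pose b (i : 'I_r) := Ordinal (ltr i).
exists (fun i => c (b i) - c (a i))%R => j sorted_j.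
have size_ab : size (interleave a b j) == 2 ^ l.+2.
  by rewrite size_interleave size_tuple -expnS.
(* Each index i of [j] is replaced by the pair 2i, 2i+1, which keeps the list increasing and doubles
   its length. *)
have [] := cE (Tuple size_ab).
  rewrite map_interleave /=.
  have := @sorted_interleave_double _ sorted_j.
  by rewrite /interleave -map_comp.
by move=> e Ee; rewrite map_interleave partial_interleave; exists e.
Qed.

Lemma FS_fset n x : FS n x ->
  exists2 a : {fset nat}, in_calF a & x = \sum_(j <- a) n j.
Proof.
case=> s [s_neq0 s_pos s_sorted ->].
have s_uniq : uniq s by apply: (sorted_uniq ltn_trans ltnn).
exists [fset j in s]%fset; last first.
  apply/perm_big/uniq_perm => // [|j]; first exact: fset_uniq.
  by rewrite inE.
split; last by rewrite inE; apply/negP => /(allP s_pos).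
case: s s_neq0 {s_pos s_sorted s_uniq} => // x0 s _ /fsetP/(_ x0).
by rewrite !inE eqxx.
Qed.

Lemma FS_not_Delta2 n r : 10 <= r -> sums_only_disjointly n ->
  ~ is_Delta_set 2 r (FS n).
Proof.
(* A successor length gives access to [inord], which is faithful on the indices 0, ..., 9 used
   below. *)
case: r => // r le_10r nE [c cE].
pose d i j k m : int :=
  ((c (inord m) - c (inord k)) - (c (inord j) - c (inord i)))%R.
have dE i j k m : i < j -> j < k -> k < m -> m < 10 ->
    exists2 A : {fset nat}, in_calF A & d i j k m = Posz (\sum_(t <- A) n t).
  move=> ij jk km m10.
  have [] := cE [tuple inord i; inord j; inord k; inord m].
    by rewrite /= !inordK; lia.
  by move=> e /FS_fset[A FA ->] eq_d; exists A.
have glue (A B C : {fset nat}) (x y z : int) :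
    in_calF A -> in_calF B -> in_calF C ->
    x = Posz (\sum_(t <- A) n t) -> y = Posz (\sum_(t <- B) n t) ->
    z = Posz (\sum_(t <- C) n t) -> (x + y = z)%R ->
    (A `|` B)%fset = C /\ (A `&` B)%fset = fset0.
  by move=> FA FB FC -> -> -> eqz; apply: nE => //; lia.
(* The difference c_m - c_k cancels in the sum of the two [d]; [A] may belong to either summand, the
   other one being supplied by [dE]. *)
have chain i j k m u v (A B : {fset nat}) :
    k < m -> m < u -> u < v -> v < 10 -> i < j -> j < k ->
    in_calF A -> in_calF B ->
    d i j u v = Posz (\sum_(t <- B) n t) ->
    (d i j k m = Posz (\sum_(t <- A) n t) \/
     d k m u v = Posz (\sum_(t <- A) n t)) -> (A `<=` B)%fset.
  move=> km mu uv v10 ij jk FA FB eB.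
  have add_d : (d i j k m + d k m u v = d i j u v)%R by rewrite /d; ring.
  case=> eA.
    have [//|//|//|//|X FX eX] := dE k m u v.
    by have [<- _] := glue _ _ _ _ _ _ FA FX FB eA eX eB add_d; apply: fsubsetUl.
  have [//|//|//|//|X FX eX] := dE i j k m; first by lia.
  by have [<- _] := glue _ _ _ _ _ _ FX FA FB eX eA eB add_d; apply: fsubsetUr.
have [//|//|//|//|A FA eA] := dE 3 4 5 6.
have [//|//|//|//|C1 FC1 eC1] := dE 0 1 5 6.
have [//|//|//|//|C2 FC2 eC2] := dE 1 2 5 6.
(* The pairs 0 1 and 1 2 share the index 1, and 7 8 and 8 9 share 8, so that c_1 and c_8 cancel in
   [add_d] below. *)
have [//|//|//|//|E1 FE1 eE1] := dE 0 1 7 8.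
have [//|//|//|//|E2 FE2 eE2] := dE 1 2 8 9.
have [//|//|//|//|G FG eG] := dE 0 2 7 9.
have AC1 : (A `<=` C1)%fset by apply: (chain 0 1 3 4 5 6) => //; right.
have AC2 : (A `<=` C2)%fset by apply: (chain 1 2 3 4 5 6) => //; right.
have CE1 : (C1 `<=` E1)%fset by apply: (chain 0 1 5 6 7 8) => //; left.
have CE2 : (C2 `<=` E2)%fset by apply: (chain 1 2 5 6 8 9) => //; left.
have add_d : (d 0 1 7 8 + d 1 2 8 9 = d 0 2 7 9)%R by rewrite /d; ring.
have [_ E12] := glue _ _ _ _ _ _ FE1 FE2 FG eE1 eE2 eG add_d.
case: FA => A_neq0 _; apply: A_neq0; apply/eqP.
by rewrite -fsubset0 -E12 fsubsetI !(fsubset_trans _ CE1, fsubset_trans _ CE2).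
Qed.

Theorem theorem8p11 (n : nat -> nat)
  (n_pos : forall k : nat, 1 <= k -> 1 <= n k)
  (n_incr : forall i j : nat, 1 <= i -> i < j -> n i < n j)
  (n_sums : forall a b g : {fset nat},
     in_calF a -> in_calF b -> in_calF g ->
     (\sum_(j <- a) n j + \sum_(j <- b) n j = \sum_(j <- g) n j
      <-> (a `|` b)%fset = g /\ (a `&` b)%fset = fset0)) :
  forall l : nat, 2 <= l -> ~ is_Delta_set l (14 * 2 ^ (l - 2)) (FS n).
Proof.
have n_disj : sums_only_disjointly n.
  by move=> a b g Fa Fb Fg; apply: (iffLR (n_sums a b g Fa Fb Fg)).
case=> [|[|l]] // _; rewrite subn2 /=.
(* At l = 2 the length is 14, which is at least 10; each further level doubles the length, and
   halving undoes this. *)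
elim: l => [|l IHl]; first exact: FS_not_Delta2.
by rewrite expnS mulnCA => /Delta_set_halve.
Qed.
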